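(* Let $G$ be an Abelian group. A subset $X \subseteq G$ is midconvex if and only if for every $g\in G$ and every $x\in X$, the set $\{n\in\mathbb{Z} : x+ng\in X\}$ is equal to $C\cap H$ for some order-convex set $C\subseteq\mathbb{Z}$ and some subgroup $H\subseteq\mathbb{Z}$ such that the quotient group $\mathbb{Z}/H$ has no elements of even order.
   Context: Abelian groups are written additively. A subset $X$ of an Abelian group $G$ is called midconvex if for every $x,y\in X$ the set $\frac{x+y}{2} := \{z\in G : 2z = x+y\}$ is a subset of $X$. A subset $C\subseteq\mathbb{Z}$ is order-convex (in $\mathbb{Z}$) if for every $a,b\in C$ the set $\{n\in\mathbb{Z} : a\le n\le b\}$ is a subset of $C$. The order of an element $g$ of a group is the smallest positive integer $n$ such that $ng=0$; if $ng\neq 0$ for all positive integers $n$, then $g$ has infinite order (which counts as neither even nor odd). *)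

(* Defs.v *)
From HB Require Import structures.
From mathcomp Require Import all_boot all_order all_algebra.
From mathcomp Require Import boolp classical_sets num_normedtype.

Set Implicit Arguments.
Unset Strict Implicit.
Unset Printing Implicit Defensive.

Import Order.TTheory GRing.Theory Num.Theory.
Local Open Scope classical_set_scope.
Local Open Scope ring_scope.

(** [midpoints x y] is the set (x + y)/2; it may be empty, and it may have
    several elements when G has 2-torsion. *)
Definition midpoints (G : zmodType) (x y : G) : set G :=
  [set z | z *+ 2 = x + y].

Definition midconvex (G : zmodType) (X : set G) : Prop :=
  forall x y, X x -> X y -> midpoints x y `<=` X.

(** Elements of infinite order satisfy [has_order g n] for no n. *)
Definition has_order (G : zmodType) (g : G) (n : nat) : Prop :=
  [/\ (0 < n)%N, g *+ n = 0
    & forall m, (0 < m)%N -> g *+ m = 0 -> (n <= m)%N].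

Definition no_even_order (G : zmodType) : Prop :=
  forall (g : G) (n : nat), has_order g n -> odd n.

(** For a subgroup H of int, [Quotient.quot H] is the library's quotient of the
    additive group by H; H need not be a proper ideal, so H = int is allowed. *)
Definition quotient_group (H : zmodClosed int) : zmodType := Quotient.quot H.

(* Main.v *)
Require Import Defs.
From mathcomp Require Import all_boot all_order all_algebra.
From mathcomp Require Import boolp classical_sets num_normedtype.
From mathcomp Require Import zify.

(** The trace of X on the progression x + Zg is a set of integers, and pulling
    back along n |-> x + ng preserves midconvexity; so the direct implication
    is about a midconvex set A of integers that contains 0
    ([midconvex_int_decomposition]).  If A has two elements, let d > 0 be the
    least difference between two of its elements.  The midpoint of two elements
    at distance d would be nearer to both, so d is odd ([least_gap_odd]).  If
    c and c + d are in A and A has an element beyond c + d, then the smallest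
    such element f differs from c + d by an odd number, as their midpoint would
    be smaller; so f has the parity of c, the midpoint of c and f is in A, it
    can only be c + d, and f = c + 2d ([least_gap_next]).  So all consecutive
    gaps equal d: A consists of the multiples of d in its convex hull, and Z/dZ
    has odd order.  If A = {0}, then H = 0 works because Z has no torsion.

    For the converse, a midpoint z of x and y gives y = x + 2(z - x).  The
    trace C `&` H of X on the progression x + Z(z - x) contains 0 and 2, so 1
    is in C by convexity and in H because Z/H has no element of order 2; hence
    z is in X.

    Both directions use the assumption on Z/H in the form: 2k in H implies k
    in H ([no_even_order_quotientP]). *)

Import Order.TTheory GRing.Theory Num.Theory.

Local Open Scope classical_set_scope.
Local Open Scope ring_scope.

(** An element of order 2m has a multiple of order 2, namely its m-th one. *)
Lemma no_even_orderP (G : zmodType) :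
  no_even_order G <-> forall h : G, h *+ 2 = 0 -> h = 0.
Proof.
split=> [noeven h h2 | no2 g n [n_gt0 gn0 n_min]].
  apply/eqP; apply: contrapT => /negP/eqP h_neq0.
  suff /noeven : has_order h 2 by [].
  by split=> // -[|[|m]] // _ h1; rewrite -(mulr1n h) h1 eqxx in h_neq0.
apply: contraT => n_even.
have n2 : n = (n./2 * 2)%N by lia.
have gn2 : g *+ n./2 = 0 by apply: no2; rewrite -mulrnA -n2.
have : (n <= n./2)%N by apply: n_min => //; lia.
by lia.
Qed.

Lemma no_even_order_quotientP (H : zmodClosed int) :
  no_even_order (quotient_group H) <-> forall k, k *+ 2 \in H -> k \in H.
Proof.
have pi0 k : (\pi_(Quotient.quot H) k = 0)%qT <-> k \in H.
  rewrite -{2}(subr0 k) Quotient.idealrBE.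
  by rewrite raddf0; split=> [->|/eqP].
rewrite no_even_orderP; split=> [no2 k | halve h].
  by rewrite -!pi0 raddfMn; apply: no2.
by rewrite -[h]reprK -raddfMn !pi0; apply: halve.
Qed.

(** Reflection lets each one-sided argument about sets of integers below serve
    for the other side. *)
Lemma midconvex_preim_opp {G : zmodType} {X : set G} :
  midconvex X -> midconvex [set x | X (- x)].
Proof.
move=> mX x y Xx Xy z /= z2; apply: (mX _ _ Xx Xy).
by rewrite /midpoints /= mulNrn z2 opprD.
Qed.

Lemma midconvex_preim_progression {G : zmodType} {X : set G} (x g : G) :
  midconvex X -> midconvex [set n : int | X (x + g *~ n)].
Proof.
move=> mX a b Xa Xb m /= m2; apply: (mX _ _ Xa Xb).
by rewrite /midpoints /= [RHS]addrACA -mulrzDr -m2 !mulr2n mulrzDr addrACA.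
Qed.

Definition least_gap (A : set int) (d : int) : Prop :=
  [/\ 0 < d, exists2 c, A c & A (c + d)
    & forall a b, A a -> A b -> a < b -> d <= b - a].

Lemma least_gap_exists {A : set int} {a b : int} :
  A a -> A b -> a != b -> exists d, least_gap A d.
Proof.
move=> Aa Ab a_neq_b.
pose gap n := `[< (0 < n)%N /\ exists2 c, A c & A (c + n%:Z) >].
have : exists n, gap n.
  wlog a_lt_b : a b Aa Ab a_neq_b / a < b => [th|].
    case: (ltrgtP a b) a_neq_b => // ? _; first by apply: (th a b) => //; lia.
    by apply: (th b a) => //; lia.
  exists `|b - a|%N; apply/asboolP; split; first by lia.
  by exists a => //; rewrite (_ : _ + _ = b) //; lia.
case/ex_minnP=> n /asboolP[n_gt0 Agap] n_min.
exists n%:Z; split=> // x y Ax Ay x_lt_y.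
suff : (n <= `|y - x|)%N by lia.
apply: n_min; apply/asboolP; split; first by lia.
by exists x => //; rewrite (_ : _ + _ = y) //; lia.
Qed.

Lemma least_gap_preim_opp {A : set int} {d : int} :
  least_gap A d -> least_gap [set n | A (- n)] d.
Proof.
case=> d_gt0 [c Ac Acd] d_min; split=> //.
  exists (- (c + d)); rewrite /= ?opprK // (_ : - _ = c) //; lia.
by move=> a b Aa Ab a_lt_b; have := d_min _ _ Ab Aa; lia.
Qed.

Lemma least_gap_odd {A : set int} {d : int} :
  midconvex A -> least_gap A d -> odd `|d|%N.
Proof.
move=> mA [d_gt0 [c Ac Acd] d_min].
apply: contraT => d_even; pose m := c + (`|d|./2)%N%:Z.
have Am : A m.
  by apply: (mA _ _ Ac Acd); rewrite /midpoints /= mulr2n /m; lia.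
by have := d_min _ _ Ac Am; rewrite /m; lia.
Qed.

(** The induction is on the distance from c to f.  Since d is odd, f has the
    parity of c or of c + d, so one of the two has a midpoint with f.  That
    midpoint is a nearer element beyond c + d, unless it is c + d itself, and
    then f is c + 2d; it cannot lie strictly between c and c + d because d is
    the least gap. *)
Lemma least_gap_next {A : set int} {d c f : int} :
  midconvex A -> least_gap A d ->
  A c -> A (c + d) -> A f -> c + d < f -> A (c + d + d).
Proof.
move=> mA gap Ac Acd; have d_odd := least_gap_odd mA gap.
case: gap => d_gt0 _ d_min.
have [n] := ubnP `|f - c|%N; elim: n f => // n IHn f lt_n Af lt_f.
have mid a : A a -> ~~ odd `|f - a|%N -> A (a + ((f - a) %/ 2)%Z).
  move=> Aa even_fa; apply: (mA _ _ Aa Af).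
  by rewrite /midpoints /= mulr2n; lia.
have [even_fe|odd_fe] := boolP (~~ odd `|f - (c + d)%R|%N).
  by apply: (IHn _ _ (mid _ Acd even_fe)); lia.
have even_fc : ~~ odd `|f - c|%N by lia.
have Am := mid _ Ac even_fc.
have := d_min _ _ Ac Am.
have [m_eq _|m_neq gap_m] := eqVneq (c + ((f - c) %/ 2)%Z) (c + d).
  by rewrite (_ : c + d + d = f) //; lia.
by apply: (IHn _ _ Am); lia.
Qed.

(** Moving the pair of elements at distance d one step to the right at a time
    reaches every c + nd that does not exceed the given element f. *)
Lemma least_gap_fill_right {A : set int} {d c f : int} (n : nat) :
  midconvex A -> least_gap A d ->
  A c -> A (c + d) -> A f -> c + d *+ n <= f -> A (c + d *+ n).
Proof.
move=> mA gap + + Af; have [d_gt0 _ d_min] := gap.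
elim: n c => [|n IHn] c Ac Acd; first by rewrite mulr0n addr0.
rewrite mulrS addrA => le_f.
have [->|n_gt0] := posnP n; first by rewrite mulr0n addr0.
apply: IHn => //; apply: (least_gap_next mA gap Ac Acd Af).
apply: lt_le_trans le_f; rewrite ltrDl.
by rewrite pmulrn_lgt0.
Qed.

(** The largest c + nd with c + nd <= f is in A, and its distance to f is less
    than the least gap. *)
Lemma least_gap_dvd_right {A : set int} {d c f : int} :
  midconvex A -> least_gap A d ->
  A c -> A (c + d) -> A f -> c <= f -> (d %| f - c)%Z.
Proof.
move=> mA gap Ac Acd Af le_cf; have [d_gt0 _ d_min] := gap.
pose n := `|((f - c) %/ d)%Z|%N.
have quot_eq : ((f - c) %/ d)%Z = n%:Z.
  by rewrite /n gez0_abs // divz_ge0 //; lia.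
have rem_eq : ((f - c) %% d)%Z = f - (c + d *+ n).
  by have := divz_eq (f - c) d; rewrite quot_eq -mulr_natr natz; lia.
have := ltz_pmod (f - c) d_gt0; have := modz_ge0 (f - c) (lt0r_neq0 d_gt0).
rewrite rem_eq => ge0 lt_d.
have Ae : A (c + d *+ n).
  by apply: (least_gap_fill_right _ mA gap Ac Acd Af); lia.
apply/dvdz_mod0P; rewrite rem_eq.
have [lt_ef|] := boolP (c + d *+ n < f); last by lia.
by have := d_min _ _ Ae Af lt_ef; lia.
Qed.

Lemma least_gap_dvd {A : set int} {d a b : int} :
  midconvex A -> least_gap A d -> A a -> A b -> (d %| b - a)%Z.
Proof.
move=> mA gap Aa Ab; have [d_gt0 [c Ac Acd] _] := gap.
suff from_c f : A f -> (d %| f - c)%Z.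
  have -> : b - a = (b - c) - (a - c) by lia.
  by apply: rpredB; apply: from_c.
move=> Af; have [|lt_fc] := lerP c f.
  exact: least_gap_dvd_right mA gap Ac Acd Af.
(* In the reflected set the pair c, c + d becomes - (c + d), - c. *)
have mN := midconvex_preim_opp mA; have gapN := least_gap_preim_opp gap.
have dvdN : (d %| - f - - (c + d))%Z.
  apply: (least_gap_dvd_right mN gapN); last by lia.
  - by rewrite /= opprK.
  - by rewrite /= opprD opprK addrK.
  - by rewrite /= opprK.
have -> : f - c = d - (- f - - (c + d)) by lia.
by rewrite rpredB.
Qed.

Lemma least_gap_fill {A : set int} {d a b n : int} :
  midconvex A -> least_gap A d ->
  A a -> A b -> a <= n <= b -> (d %| n - a)%Z -> A n.
Proof.
move=> mA gap Aa Ab /andP[le_an le_nb] dvd_na.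
have [d_gt0 [c Ac Acd] _] := gap.
have /dvdzP[q n_eq] : (d %| n - c)%Z.
  have -> : n - c = n - a + (a - c) by lia.
  by rewrite rpredD // (least_gap_dvd mA gap Ac Aa).
have [le_cn|lt_nc] := lerP c n.
  have n_eq' : n = c + d *+ `|q|%N by rewrite -mulr_natr natz; nia.
  by rewrite n_eq'; apply: (least_gap_fill_right _ mA gap Ac Acd Ab); lia.
have mN := midconvex_preim_opp mA; have gapN := least_gap_preim_opp gap.
(* Seen from the reflected pair, which starts at - (c + d), the integer
   - n = - c - qd is 1 - q steps of length d away. *)
have n_eq' : - n = - (c + d) + d *+ `|1 - q|%N by rewrite -mulr_natr natz; nia.
have : [set k | A (- k)] (- (c + d) + d *+ `|1 - q|%N).
  apply: (@least_gap_fill_right _ _ _ (- a) _ mN gapN); last by lia.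
  - by rewrite /= opprK.
  - by rewrite /= opprD opprK addrK.
  - by rewrite /= opprK.
by rewrite -n_eq' /= opprK.
Qed.

(** C is the convex hull of A, and H = dZ, where d is the least gap of A, or 0
    if A is reduced to 0.  Divisibility by 2 can be cancelled modulo d because
    d is odd or 0. *)
Lemma midconvex_int_decomposition {A : set int} : midconvex A -> A 0 ->
  exists (C : set int) (H : zmodClosed int),
    [/\ is_interval C, forall k, k *+ 2 \in H -> k \in H
      & A = C `&` [set n : int | n \in H]].
Proof.
move=> mA A0.
pose hull := [set n | exists a b, [/\ A a, A b & a <= n <= b]].
have hull_interval : is_interval hull.
  move=> x y [a [a' [Aa _ x_in]]] [b' [b [_ Ab y_in]]] z z_in.
  by exists a, b; split=> //; lia.
have sub_hull n : A n -> hull n by move=> An; exists n, n; split=> //; lia.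
suff [d [halve A_dvd fill]] : exists d : int,
    [/\ forall k, (d %| k *+ 2)%Z -> (d %| k)%Z, forall n, A n -> (d %| n)%Z
      & forall a b n, A a -> A b -> a <= n <= b -> (d %| n)%Z -> A n].
  exists hull, (GRing.ZmodClosed.clone int (dvdz d) _); split=> //.
  apply/seteqP; split=> [n An|n [[a [b [Aa Ab n_in]]] /= dvd_n]].
    by split; [apply: sub_hull|apply: A_dvd].
  exact: fill Aa Ab n_in dvd_n.
have [A_single|] := pselect (forall n, A n -> n = 0).
  exists 0; split=> [k|n /A_single -> //|a b n _ _ _].
    by rewrite !dvd0z mulrn_eq0.
  by rewrite dvd0z => /eqP ->.
move=> /existsNP[b /not_implyP[Ab /eqP b_neq0]].
have [d gap] := least_gap_exists Ab A0 b_neq0.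
have A_dvd n : A n -> (d %| n)%Z.
  by move=> An; rewrite -(subr0 n) (least_gap_dvd mA gap A0 An).
exists d; split=> // [k|x y n Ax Ay n_in dvd_n].
  rewrite -mulr_natr Gauss_dvdzl // coprimezE coprimen2.
  exact: least_gap_odd mA gap.
by apply: (least_gap_fill mA gap Ax Ay n_in); rewrite rpredB // A_dvd.
Qed.

Theorem theorem2 (G : zmodType) (X : set G) :
  midconvex X <->
  (forall g x : G, X x ->
     exists (C : set int) (H : zmodClosed int),
       [/\ is_interval C,
           no_even_order (quotient_group H)
         & [set n : int | X (x + g *~ n)] = C `&` [set n : int | n \in H]]).
Proof.
split=> [mX g x Xx | traces x y Xx Xy z z2].
  have [|C [H [C_itv H_halve A_eq]]] :=
      midconvex_int_decomposition (midconvex_preim_progression x g mX).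
    by rewrite /= mulr0z addr0.
  by exists C, H; split=> //; apply/no_even_order_quotientP.
have [C [H [C_itv /no_even_order_quotientP H_halve A_eq]]] :=
  traces (z - x) x Xx.
have traceP n : X (x + (z - x) *~ n) <-> C n /\ n \in H.
  by rewrite -[X _]/([set k : int | X (x + (z - x) *~ k)] n) A_eq.
have [C0 _] : C 0 /\ 0 \in H by apply/traceP; rewrite mulr0z addr0.
have [C2 H2] : C 2 /\ 2 \in H.
  apply/traceP; rewrite -[(_ *~ 2)]/((z - x) *+ 2) mulrnBl z2 mulr2n.
  by rewrite opprD addrACA subrr add0r addrCA subrr addr0.
have : X (x + (z - x) *~ 1).
  by apply/traceP; split; [apply: (C_itv _ _ C0 C2)|apply: H_halve].
by rewrite mulr1z addrCA subrr addr0.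
Qed.
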